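(* Let $\mathbf{k}$ be an algebraically closed field of characteristic zero and $G=\mathbb{Z}_{m_1}\times\cdots\times\mathbb{Z}_{m_n}$, where $g_i$ is a fixed generator of $\mathbb{Z}_{m_i}$ ($1\le i\le n$). Let $A$ be the set of all integer sequences $\underline{\mathbf a}=\big((a_l)_{1\le l\le n},(a_{st})_{1\le s<t\le n},(a_{rst})_{1\le r<s<t\le n}\big)$ with $0\le a_l<m_l$, $0\le a_{st}<\gcd(m_s,m_t)$, $0\le a_{rst}<\gcd(m_r,m_s,m_t)$. For $\underline{\mathbf a}\in A$ define $\Phi_{\underline{\mathbf a}}:G\times G\times G\to\mathbf{k}^*$ by $$\Phi_{\underline{\mathbf a}}\big(g_1^{i_1}\cdots g_n^{i_n},\,g_1^{j_1}\cdots g_n^{j_n},\,g_1^{k_1}\cdots g_n^{k_n}\big)=\prod_{l=1}^{n}\zeta_{m_l}^{a_l i_l\left[\frac{j_l+k_l}{m_l}\right]}\prod_{1\le s<t\le n}\zeta_{m_t}^{a_{st}i_t\left[\frac{j_s+k_s}{m_s}\right]}\prod_{1\le r<s<t\le n}\zeta_{(m_r,m_s,m_t)}^{-a_{rst}k_rj_si_t}$$ for $0\le i_l,j_l,k_l<m_l$. Then $\{\Phi_{\underline{\mathbf a}}\mid \underline{\mathbf a}\in A\}$ is a complete set of representatives of normalized $3$-cocycles on $G$ (with values in $\mathbf{k}^*$, modulo coboundaries).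
   Context: $[x]$ denotes the integer part of $x$. For every natural number $m$, $\zeta_m\in\mathbf{k}$ is a fixed primitive $m$-th root of unity. $(m_r,m_s,m_t)$ denotes the greatest common divisor. $\mathbf{k}^*=\mathbf{k}\setminus\{0\}$ is regarded as a trivial $G$-module. A normalized $3$-cocycle is a map $\Phi:G^3\to\mathbf{k}^*$ with $\Phi(a,b,cd)\Phi(ab,c,d)=\Phi(b,c,d)\Phi(a,bc,d)\Phi(a,b,c)$ and $\Phi(a,1,b)=1$. ''Complete set of representatives'' means that each element of the set is a normalized $3$-cocycle and that each class in $H^3(G,\mathbf{k}^* )$ is represented by exactly one element of the set. *)

(* Defs.v *)
From HB Require Import structures.
From mathcomp Require Import all_boot all_order all_algebra.
From mathcomp Require Import all_fingroup all_solvable.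

Set Implicit Arguments.
Unset Strict Implicit.
Unset Printing Implicit Defensive.

Import GRing.Theory.
Local Open Scope ring_scope.

(* Low-degree inhomogeneous cochains of a finite group with values in the      *)
(* trivial module k^* = k \ {0}: k-valued finite functions without zeros.      *)
Section Cohomology.
Variables (k : fieldType) (gT : finGroupType).

Definition cochain2 (h : {ffun gT * gT -> k}) : Prop := forall x, h x != 0.

Definition cochain3 (f : {ffun gT * gT * gT -> k}) : Prop :=
  forall x, f x != 0.

Definition cocycle3 (f : {ffun gT * gT * gT -> k}) : Prop :=
  cochain3 f /\
  forall a b c d : gT,
    f (a, b, (c * d)%g) * f ((a * b)%g, c, d) =
    f (b, c, d) * f (a, (b * c)%g, d) * f (a, b, c).

Definition normalized_cocycle3 (f : {ffun gT * gT * gT -> k}) : Prop :=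
  cocycle3 f /\ forall a b : gT, f (a, 1%g, b) = 1.

Definition coboundary2 (h : {ffun gT * gT -> k}) : {ffun gT * gT * gT -> k} :=
  [ffun x : gT * gT * gT => let: (a, b, c) := x in
    h (b, c) * h (a, (b * c)%g) / (h ((a * b)%g, c) * h (a, b))].

(* f1 and f2 have the same class in H^3(gT, k^* ). *)
Definition cohomologous3 (f1 f2 : {ffun gT * gT * gT -> k}) : Prop :=
  exists2 h, cochain2 h & forall x, f1 x = f2 x * coboundary2 h x.

Definition complete_normalized_representatives3
    (S : {ffun gT * gT * gT -> k} -> Prop) : Prop :=
  (forall F, S F -> normalized_cocycle3 F) /\
  (forall f, cocycle3 f -> exists! F, S F /\ cohomologous3 F f).

End Cohomology.

(* (a_l), (a_st), (a_rst).  Only the entries with s < t, resp. r < s < t, are   *)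
(* constrained or used; the other ones are irrelevant.                         *)
Record cocycle_index (n : nat) := CocycleIndex {
  idx1 : 'I_n -> nat;
  idx2 : 'I_n -> 'I_n -> nat;
  idx3 : 'I_n -> 'I_n -> 'I_n -> nat
}.

Definition admissible_index n (m : 'I_n -> nat) (a : cocycle_index n) : Prop :=
  [/\ forall l, (idx1 a l < m l)%N,
      forall s t : 'I_n, (s < t)%N -> (idx2 a s t < gcdn (m s) (m t))%N
    & forall r s t : 'I_n, (r < s)%N -> (s < t)%N ->
        (idx3 a r s t < gcdn (gcdn (m r) (m s)) (m t))%N].

Definition Phi_exponents (k : fieldType) (zeta : nat -> k) n (m : 'I_n -> nat)
    (a : cocycle_index n) (i j e : 'I_n -> nat) : k :=
  (\prod_(l < n) zeta (m l) ^+ (idx1 a l * i l * ((j l + e l) %/ m l)))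
  * (\prod_(s < n) \prod_(t < n | (s < t)%N)
       zeta (m t) ^+ (idx2 a s t * i t * ((j s + e s) %/ m s)))
  * (\prod_(r < n) \prod_(s < n | (r < s)%N) \prod_(t < n | (s < t)%N)
       zeta (gcdn (gcdn (m r) (m s)) (m t)) ^- (idx3 a r s t * e r * j s * i t)).

(* The unique e < #[g] with x = g ^+ e, for x in <[g]>. *)
Definition exponent_of (gT : finGroupType) (g x : gT) : nat :=
  index x [seq (g ^+ e)%g | e <- iota 0 #[g]%g].

(* The group Z_1 x ... x Z_n is {dffun forall l, Z l} with the componentwise   *)
(* group structure of gproduct.                                                *)
Definition Phi (k : fieldType) (zeta : nat -> k) n (m : 'I_n -> nat)
    (Z : 'I_n -> finGroupType) (g : forall l, Z l) (a : cocycle_index n) :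
    {ffun {dffun forall l, Z l} * {dffun forall l, Z l} * {dffun forall l, Z l}
       -> k} :=
  [ffun x : {dffun forall l, Z l} * {dffun forall l, Z l}
              * {dffun forall l, Z l} =>
     let: (u, v, w) := x in
     Phi_exponents zeta m a (fun l => exponent_of (g l) (u l))
       (fun l => exponent_of (g l) (v l)) (fun l => exponent_of (g l) (w l))].

Lemma exponent_of_expg (gT : finGroupType) (g : gT) (e : nat) :
  (e < #[g]%g)%N -> exponent_of g (g ^+ e)%g = e.
Proof.
move=> lt_e; rewrite /exponent_of.
have E : (g ^+ e)%g = nth 1%g [seq (g ^+ d)%g | d <- iota 0 #[g]%g] e.
  by rewrite (nth_map 0%N) ?size_iota // nth_iota.
rewrite E index_uniq ?size_map ?size_iota //.
rewrite map_inj_in_uniq ?iota_uniq // => d1 d2.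
rewrite !mem_iota !add0n => /= lt1 lt2 /eqP.
by rewrite eq_expg_mod_order !modn_small // => /eqP.
Qed.

Definition monomial n (Z : 'I_n -> finGroupType) (g : forall l, Z l)
    (e : 'I_n -> nat) : {dffun forall l, Z l} :=
  (\prod_(l < n) dfung1 (g l) ^+ e l)%g.

Lemma monomialE n (Z : 'I_n -> finGroupType) (g : forall l, Z l) e l :
  monomial g e l = (g l ^+ e l)%g.
Proof.
rewrite /monomial (big_morph (fun x : {dffun forall l, Z l} => x l)
  (@dffunM _ Z l) (_ : _ = 1%g)) ?ffunE //.
have X (x : {dffun forall l, Z l}) d : (x ^+ d)%g l = (x l ^+ d)%g.
  by elim: d => [|d IH]; rewrite ?ffunE // !expgS dffunM IH.
rewrite (big_only1 l) ?X ?dfung1_id // => i ne _.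
by rewrite X dfung1_dflt // expg1n.
Qed.

(* The defining formula of Phi_a. *)
Lemma Phi_monomial (k : fieldType) (zeta : nat -> k) n (m : 'I_n -> nat)
    (Z : 'I_n -> finGroupType) (g : forall l, Z l) (a : cocycle_index n)
    (i j e : 'I_n -> nat) :
  (forall l, #[g l]%g = m l) ->
  (forall l, [/\ (i l < m l)%N, (j l < m l)%N & (e l < m l)%N]) ->
  Phi zeta m g a (monomial g i, monomial g j, monomial g e) =
  Phi_exponents zeta m a i j e.
Proof.
move=> om lt; rewrite ffunE /Phi_exponents.
have K (d : 'I_n -> nat) l : (d l < m l)%N ->
    exponent_of (g l) (monomial g d l) = d l.
  by move=> ltd; rewrite monomialE exponent_of_expg // om.
congr (_ * _ * _).
- by apply: eq_bigr => l _; case: (lt l) => *; rewrite !K.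
- apply: eq_bigr => s _; apply: eq_bigr => t _.
  by case: (lt s) (lt t) => ? ? ? [? ? ?]; rewrite !K.
- apply: eq_bigr => r _; apply: eq_bigr => s _; apply: eq_bigr => t _.
  by case: (lt r) (lt s) (lt t) => ? ? ? [? ? ?] [? ? ?]; rewrite !K.
Qed.

(* Main.v *)
Require Import Defs.
From mathcomp Require Import all_boot all_order all_algebra.
From mathcomp Require Import all_fingroup all_solvable.
From mathcomp Require Import ring zify.

Set Implicit Arguments.
Unset Strict Implicit.
Unset Printing Implicit Defensive.

Import GRing.Theory.
Local Open Scope ring_scope.

(** A class of H^3(G, k^x) is detected by explicit numbers attached to the
    generators x_i of the cyclic factors: the numbers [slant f m_i x_i x_h],
    products of the slant product of f by x_h along the cycle of x_i, and the
    alternating products [alt3 f x_i x_j x_l] over the six orderings.  Both are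
    multiplicative in f.

    They detect the class by dimension shifting.  Read a cocycle f(a, b, c) as
    a function of a: it becomes a 2-cocycle of G with values in the module of
    nowhere zero functions on G modulo constants, that is, an extension of G by
    this module, and f is a coboundary as soon as the extension splits
    ([coboundary_of_left_primitive]).  Since G is a product of cyclic groups,
    the extension splits when the x_i have commuting lifts whose m_i-th powers
    are trivial ([orbit_map_equivariant], [cocycle3_split_coboundary]).  The
    obvious lift of x_i has m_i-th power z_i = [normf], and the commutators of
    these lifts are the functions y_ij = [commf]; another choice of lifts
    divides (z, y) by the coboundary of a family (w_i) of functions.  So the
    question is whether (z, y), taken modulo constants, is such a coboundary in
    the complex computed from the tensor product of the periodic resolutions of
    the cyclic factors.  As an honest family of functions, (z, y) is closed up
    to constants, and these constants are exactly the slants and the alternating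
    products ([normf_shift], [commf_shift]).  When constants u_ij can be put on
    the y_ij so as to make the defects trivial, (z, y) is closed, hence exact,
    because functions on G form a coinduced module ([closed2_exact]).  This
    gives [coboundary_criterion].

    What remains is arithmetic of roots of unity.  The closedness relations,
    multiplied along a cycle, show that the numbers of f satisfy
    slant_ii ^ m_i = 1, slant_st ^ m_t * slant_ts ^ m_s = 1 and
    alt3_rst ^ gcd(m_r, m_s, m_t) = 1, while Phi_a has slant_ll = zeta ^ a_l,
    slant_st = zeta ^ a_st and slant_ts = 1 for s < t, and
    alt3_tsr = zeta ^ - a_rst ([slant_Phi_diag], [slant_Phi], [alt3_Phi]).
    Hence some Phi_a matches f up to the allowed constants u.  Conversely a
    coboundary has trivial slant_ii and alt3, and slant_st = u ^ m_s,
    slant_ts = u ^ - m_t for some u ([slant_coboundary], [alt3_coboundary]); so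
    the class of Phi_a determines a_l, a_rst, and a_st modulo
    gcd(m_s, m_t). *)

(** * Products along a cycle and roots of unity *)

Lemma prod_cycle_shift (k : fieldType) (gT : finGroupType) (x : gT) (m : nat)
    (F : gT -> k) : (x ^+ m = 1)%g ->
  \prod_(j < m) F (x ^+ j.+1)%g = \prod_(j < m) F (x ^+ j)%g.
Proof.
case: m => [|m] xm; first by rewrite !big_ord0.
by rewrite big_ord_recr big_ord_recl /= xm expg0 mulrC.
Qed.

Lemma ex_root (k : closedFieldType) (d : nat) (c : k) :
  (0 < d)%N -> exists v, v ^+ d = c.
Proof.
case: d => // d d0.
have [v E] := solve_monicpoly (fun i => if i == 0 then c else 0) d0.
exists v; rewrite E big_ord_recl expr0 mulr1 big1 ?addr0 // => i _.
by rewrite mul0r.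
Qed.

Lemma expr_gcdn_eq1 (R : pzRingType) (y : R) p q : (0 < p)%N ->
  y ^+ p = 1 -> y ^+ q = 1 -> y ^+ gcdn p q = 1.
Proof.
move=> p0 yp yq; have [A _ /dvdnP[j Aj]] := Bezoutl q p0.
rewrite -[LHS]mulr1 -(expr1n _ A) -yq -exprM -exprD (mulnC q).
by rewrite Aj (mulnC j) (mulnC A) !exprM yp yq !expr1n.
Qed.

(** Adding 1 to 0, 1, ..., M - 1 modulo M produces exactly one carry, except for
    M = 1, where there is none; the bound on q covers this case, as it forces
    q = 0. *)
Lemma prod_carry (R : comPzRingType) (z : R) q M : (q < M)%N ->
  \prod_(j < M) z ^+ (q * ((j %% M + 1 %% M) %/ M)) = z ^+ q.
Proof.
case: M => [//|[|M]] qM.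
  by rewrite big_ord1; move: qM; rewrite ltnS leqn0 => /eqP->.
rewrite big_ord_recr /= big1 => [|j _].
  by rewrite !modn_small // addn1 divnn muln1 mul1r.
have lj := ltn_ord j.
by rewrite (modn_small (ltnW lj : j < M.+2)%N) modn_small // addn1 divn_small ?muln0.
Qed.

(** * The detecting numbers and the closedness relations *)

Definition slant (k : fieldType) (gT : finGroupType)
    (f : {ffun gT * gT * gT -> k}) (m : nat) (g h : gT) : k :=
  \prod_(j < m) (f (h, g ^+ j, g)%g * f (g ^+ j, g, h)%g / f (g ^+ j, h, g)%g).

Definition alt3 (k : fieldType) (gT : finGroupType)
    (f : {ffun gT * gT * gT -> k}) (a b c : gT) : k :=
  f (a, b, c) * f (b, c, a) * f (c, a, b)
  / (f (b, a, c) * f (a, c, b) * f (c, b, a)).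

Section DimensionShift.
Variables (k : fieldType) (gT : finGroupType) (f : {ffun gT * gT * gT -> k}).
Hypotheses (mulC : commutative (@mulg gT)) (cf : cocycle3 f).

Lemma cocycle3_neq0 x : f x != 0. Proof. by case: cf => /(_ x). Qed.
Let nz := cocycle3_neq0.

Lemma cocycle3_mull a b c d :
  f ((a * b)%g, c, d) =
  f (b, c, d) * f (a, (b * c)%g, d) * f (a, b, c) / f (a, b, (c * d)%g).
Proof.
case: cf => _ /(_ a b c d) E; apply: canRL (mulfK (nz _)) _.
by rewrite mulrC.
Qed.

Definition normf (m : nat) (g a : gT) : k := \prod_(j < m) f (a, g ^+ j, g)%g.
Definition commf (g h a : gT) : k := f (a, g, h) / f (a, h, g).

Lemma normf_neq0 m g a : normf m g a != 0.
Proof. by apply/prodf_neq0 => j _; apply: nz. Qed.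

Lemma commf_neq0 g h a : commf g h a != 0.
Proof. by rewrite mulf_neq0 ?invr_eq0 ?nz. Qed.

Lemma slant_neq0 m g h : slant f m g h != 0.
Proof. by apply/prodf_neq0 => j _; rewrite !mulf_neq0 ?invr_eq0 ?nz. Qed.

Lemma alt3_neq0 a b c : alt3 f a b c != 0.
Proof. by rewrite !(mulf_neq0, invr_eq0, nz). Qed.

(** The cocycle identity at (a, h, g ^ j, g) and then the exchange of g ^ j
    with h inside the second argument; the terms that depend on j only through
    g ^ j and g ^ j.+1 telescope around the cycle. *)
Lemma normf_shift m g h a : (g ^+ m = 1)%g ->
  normf m g (a * h)%g =
  slant f m g h * normf m g a * \prod_(j < m) commf h g (a * g ^+ j)%g.
Proof.
move=> gm.
pose v (x : gT) : k := f (a, h, x)%g.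
pose w (x : gT) : k := f (a, x, h)%g.
rewrite /slant /normf -!big_split /=.
transitivity (\prod_(j < m)
  (f (h, g ^+ j, g)%g * f (g ^+ j, g, h)%g / f (g ^+ j, h, g)%g
  * f (a, g ^+ j, g)%g * commf h g (a * g ^+ j)%g
  * (v (g ^+ j)%g / v (g ^+ j.+1)%g * (w (g ^+ j.+1)%g / w (g ^+ j)%g)))); last first.
  rewrite [LHS]big_split /= [X in _ * X]big_split /= !prodf_div.
  rewrite !(@prod_cycle_shift _ _ g m) // !divff ?mulr1 //.
  - by apply/prodf_neq0 => j _; apply: nz.
  - by apply/prodf_neq0 => j _; apply: nz.
apply: eq_bigr => j _; rewrite /commf /v /w.
rewrite (cocycle3_mull a h) (cocycle3_mull a (g ^+ j) h g).
rewrite (cocycle3_mull a (g ^+ j) g h).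
rewrite (mulC g h) -!expgSr (mulC h (g ^+ j)%g).
by field; rewrite !nz.
Qed.

(** A Jacobi-type identity: the six cocycle identities at (a, x, g, h) and its
    permutations are combined with signs. *)
Lemma commf_shift g h x a :
  commf g h (a * x)%g * commf h x (a * g)%g * commf x g (a * h)%g =
  alt3 f g h x * (commf g h a * commf h x a * commf x g a).
Proof.
rewrite /commf /alt3.
rewrite !(cocycle3_mull a) (mulC h g) (mulC x g) (mulC x h).
by field; rewrite !nz.
Qed.

(** For h = g the commutator vanishes, so each translation by g multiplies
    [normf m g] by the same number, and m translations have no effect. *)
Lemma slant_diag_root m g : (g ^+ m = 1)%g -> slant f m g g ^+ m = 1.
Proof.
move=> gm.
have E a : normf m g (a * g)%g = slant f m g g * normf m g a.
  rewrite normf_shift // big1 ?mulr1 // => j _.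
  by rewrite /commf divff ?nz.
have I j : normf m g (g ^+ j)%g = slant f m g g ^+ j * normf m g 1%g.
  elim: j => [|j IH]; first by rewrite expr0 expg0 mul1r.
  by rewrite expgSr E IH mulrA exprS.
by apply: (mulIf (normf_neq0 m g 1%g)); rewrite -I gm mul1r.
Qed.

(** The norm along h of the relation for (g, h) equates [slant f m g h ^+ p]
    with a double product of commutators over both cycles; exchanging g and h
    inverts that double product. *)
Lemma slant_torsion m p g h : (g ^+ m = 1)%g -> (h ^+ p = 1)%g ->
  slant f m g h ^+ p * slant f p h g ^+ m = 1.
Proof.
have N q r x y : (x ^+ q = 1)%g -> (y ^+ r = 1)%g ->
    slant f q x y ^+ r
    * \prod_(i < r) \prod_(j < q) commf y x (y ^+ i * x ^+ j)%g = 1.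
  move=> xq yr.
  have nzn : \prod_(i < r) normf q x (y ^+ i)%g != 0.
    by apply/prodf_neq0 => i _; apply: normf_neq0.
  apply: (mulIf nzn); rewrite mul1r.
  rewrite -[RHS](prod_cycle_shift _ yr).
  under [RHS]eq_bigr do rewrite expgSr normf_shift //.
  rewrite !big_split /= prodr_const card_ord; ring.
move=> gm hp; have E1 := N _ _ _ _ gm hp; have E2 := N _ _ _ _ hp gm.
set P := \prod_(i < p) _ in E1; set Q := \prod_(i < m) _ in E2.
have PQ : P * Q = 1.
  rewrite /Q exchange_big /P -big_split /= big1 // => i _.
  rewrite -big_split big1 // => j _.
  rewrite /= (mulC (g ^+ j)%g) /commf.
  by field; rewrite !nz.
by rewrite -[LHS]mulr1 -PQ mulrACA E1 E2 mulr1.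
Qed.

(** The norm along x of [commf_shift]: the norms of the commutators with x are
    quotients of values of [normf m x], which cancel. *)
Lemma alt3_root m g h x : (x ^+ m = 1)%g -> alt3 f g h x ^+ m = 1.
Proof.
move=> xm.
have H a y : \prod_(j < m) commf y x (a * x ^+ j)%g
    = normf m x (a * y)%g / (slant f m x y * normf m x a).
  by rewrite normf_shift // mulrC mulKf // mulf_neq0 ?normf_neq0 ?slant_neq0.
have H' a y : \prod_(j < m) commf x y (a * x ^+ j)%g
    = slant f m x y * normf m x a / normf m x (a * y)%g.
  rewrite -[RHS]invf_div -H -prodfV; apply: eq_bigr => j _.
  by rewrite /commf invf_div.
pose D j := commf g h (x ^+ j)%g * commf h x (x ^+ j)%g * commf x g (x ^+ j)%g.
have nzD : \prod_(j < m) D j != 0.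
  by apply/prodf_neq0 => j _; rewrite /D !mulf_neq0 ?invr_eq0 ?nz.
apply: (mulIf nzD); rewrite mul1r.
have -> : alt3 f g h x ^+ m = \prod_(j < m) alt3 f g h x.
  by rewrite prodr_const card_ord.
rewrite -big_split /=.
under eq_bigr do rewrite -commf_shift -expgSr (mulC _ g) (mulC _ h).
rewrite /D 2!big_split 2![in RHS]big_split /= (prod_cycle_shift (commf g h) xm).
have H1 y : \prod_(j < m) commf y x (x ^+ j)%g
    = normf m x y / (slant f m x y * normf m x 1%g).
  have := H 1%g y; rewrite mul1g => <-.
  by apply: eq_bigr => j _; rewrite mul1g.
have H1' y : \prod_(j < m) commf x y (x ^+ j)%g
    = slant f m x y * normf m x 1%g / normf m x y.
  have := H' 1%g y; rewrite mul1g => <-.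
  by apply: eq_bigr => j _; rewrite mul1g.
rewrite H H' H1 H1' (mulC h g).
by field; rewrite !normf_neq0 !slant_neq0.
Qed.

End DimensionShift.

(** * Groups with cyclic coordinates *)

(** An internal presentation of a product of cyclic groups, which keeps the
    cohomological arguments independent of the dependent function type of the
    external product. *)
Record cyclic_coordinates (gT : finGroupType) n (m : 'I_n -> nat)
    (x : 'I_n -> gT) (e : 'I_n -> gT -> nat) : Prop := CyclicCoordinates {
  coord_mulC : commutative (@mulg gT);
  coord_order i : (x i ^+ m i = 1)%g;
  coord_lt i a : (e i a < m i)%N;
  coordM i a b : e i (a * b)%g = ((e i a + e i b) %% m i)%N;
  coord_gen i l : e l (x i) = ((i == l) %% m l)%N;
  coord_expand a : a = (\prod_l x l ^+ e l a)%g
}.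

Section Coordinates.
Variables (gT : finGroupType) (n : nat) (m : 'I_n -> nat).
Variables (x : 'I_n -> gT) (e : 'I_n -> gT -> nat).
Hypothesis D : cyclic_coordinates m x e.

Lemma coord_gt0 i : (0 < m i)%N.
Proof. exact: leq_ltn_trans (coord_lt D i 1%g). Qed.

Lemma coord1 i : e i 1%g = 0.
Proof.
have lt := coord_lt D i 1%g; have := coordM D i 1%g 1%g; rewrite mulg1.
move/eqP; rewrite -[X in X == _](modn_small lt) -[X in (X == _ %[mod _])]addn0.
by rewrite eqn_modDl modn_small ?coord_gt0 // modn_small // => /eqP.
Qed.

Lemma coord_step i a : e i (a * x i)%g = ((e i a).+1 %% m i)%N.
Proof. by rewrite (coordM D) (coord_gen D) eqxx modnDmr addn1. Qed.

Lemma coord_other i l a : i != l -> e i (a * x l)%g = e i a.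
Proof.
move=> il; rewrite (coordM D) (coord_gen D) eq_sym (negPf il) mod0n addn0.
by rewrite modn_small ?(coord_lt D).
Qed.

Lemma coord_genX i l j :
  e l (x i ^+ j)%g = (if i == l then j %% m l else 0)%N.
Proof.
elim: j => [|j IH]; first by rewrite coord1 mod0n if_same.
rewrite expgSr; case: eqP => [il|/eqP il].
  by rewrite -il in IH *; rewrite coord_step IH eqxx -addn1 modnDml addn1.
by rewrite coord_other 1?eq_sym // IH (negPf il).
Qed.

Lemma coord_ind (P : gT -> Prop) :
  P 1%g -> (forall i b, P b -> P (x i * b)%g) -> forall b, P b.
Proof.
move=> P1 PM b; rewrite (coord_expand D b).
apply: (big_rec P) => // i y _ Py.
by elim: (e i b) => [|j IH]; rewrite ?expg0 ?mul1g // expgS -mulgA; apply: PM.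
Qed.

End Coordinates.

(** * Exactness of the function-valued complex *)

Section Acyclicity.
Variables (k : fieldType) (gT : finGroupType) (n : nat) (m : 'I_n -> nat).
Variables (x : 'I_n -> gT) (e : 'I_n -> gT -> nat).
Hypothesis D : cyclic_coordinates m x e.
Let mulC := coord_mulC D.

Definition orbit_prod (i : 'I_n) (w : gT -> k) (a : gT) : k :=
  \prod_(j < m i) w (a * x i ^+ j)%g.

(** Degree 2 cocycles, with values in nowhere zero functions on G, of the
    multiplicative complex attached to the tensor product of the periodic
    resolutions of the cyclic factors: z_i is the component of degree 2 in
    the factor i, and y_ij the one of degree 1 in each of the factors
    i and j. *)
Record closed2 (z : 'I_n -> gT -> k) (y : 'I_n -> 'I_n -> gT -> k) : Prop :=
  Closed2 {
    closed_z0 i a : z i a != 0;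
    closed_y0 i j a : y i j a != 0;
    closed_anti i j a : y i j a * y j i a = 1;
    closed_diag i a : y i i a = 1;
    closed_zy i h a : z i (a * x h)%g = z i a * orbit_prod i (y h i) a;
    closed_yy i j l a :
      y i j (a * x l)%g * y j l (a * x i)%g * y l i (a * x j)%g =
      y i j a * y j l a * y l i a
  }.

Record primitive1 (w : 'I_n -> gT -> k) (z : 'I_n -> gT -> k)
    (y : 'I_n -> 'I_n -> gT -> k) : Prop := Primitive1 {
  prim_w0 i a : w i a != 0;
  prim_z i a : orbit_prod i (w i) a = z i a;
  prim_y i j a : w j (a * x i)%g * w i a = y i j a * (w j a * w i (a * x j)%g)
}.

Definition quot_z (z w : 'I_n -> gT -> k) i a := z i a / orbit_prod i (w i) a.
Definition quot_y (y : 'I_n -> 'I_n -> gT -> k) (w : 'I_n -> gT -> k) i j a :=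
  y i j a * ((w j a * w i (a * x j)%g) / (w j (a * x i)%g * w i a)).

Lemma orbit_prod_neq0 i w a : (forall b, w b != 0) -> orbit_prod i w a != 0.
Proof. by move=> w0; apply/prodf_neq0 => j _. Qed.

Lemma orbit_prod_shift i w a : orbit_prod i w (a * x i)%g = orbit_prod i w a.
Proof.
rewrite /orbit_prod -(prod_cycle_shift (fun b => w (a * b)%g) (coord_order D i)).
by apply: eq_bigr => j _; rewrite expgS mulgA.
Qed.

(** Coboundaries are cocycles: dividing by the coboundary of w preserves
    closedness. *)
Lemma closed2_quot z y w : (forall i a, w i a != 0) -> closed2 z y ->
  closed2 (quot_z z w) (quot_y y w).
Proof.
move=> w0 [z0 y0 ya yd zy yy]; split.
- by move=> i a; rewrite mulf_neq0 ?invr_eq0 ?orbit_prod_neq0.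
- by move=> i j a; rewrite !(mulf_neq0, invr_eq0).
- move=> i j a; rewrite -[RHS](ya i j a) /quot_y.
  by field; rewrite !w0.
- by move=> i a; rewrite /quot_y yd; field; rewrite !w0.
- move=> i h a; rewrite /quot_z /quot_y zy.
  have -> : orbit_prod i (fun b => y h i b *
     ((w i b * w h (b * x i)%g) / (w i (b * x h)%g * w h b))) a
    = orbit_prod i (y h i) a
      * (orbit_prod i (w i) a * orbit_prod i (w h) (a * x i)%g
        / (orbit_prod i (w i) (a * x h)%g * orbit_prod i (w h) a)).
    rewrite /orbit_prod big_split /= prodf_div !big_split /=.
    congr (_ * (_ * _ / (_ * _))); apply: eq_bigr => j _.
      by rewrite -!mulgA (mulC (x i)).
    by rewrite -!mulgA (mulC (x h)).
  by rewrite orbit_prod_shift; field; rewrite !orbit_prod_neq0.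
- move=> i j l a; rewrite /quot_y.
  rewrite -!(mulgA a) (mulC (x l) (x j)) (mulC (x l) (x i)) (mulC (x j) (x i)).
  transitivity (y i j (a * x l)%g * y j l (a * x i)%g * y l i (a * x j)%g *
     (w j a * w i (a * x j)%g / (w j (a * x i)%g * w i a) *
     (w l a * w j (a * x l)%g / (w l (a * x j)%g * w j a)) *
     (w i a * w l (a * x i)%g / (w i (a * x l)%g * w l a)))); last first.
    by rewrite yy; field; rewrite !w0.
  by field; rewrite !w0.
Qed.

Lemma primitive1_mul w w' z y : (forall i a, w i a != 0) ->
  primitive1 w' (quot_z z w) (quot_y y w) ->
  primitive1 (fun i a => w i a * w' i a) z y.
Proof.
move=> w0 [w'0 Hz Hy]; split.
- by move=> i a; rewrite mulf_neq0.
- move=> i a; rewrite /orbit_prod big_split /= -!/(orbit_prod _ _ _) Hz /quot_z.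
  by rewrite mulrC divfK // orbit_prod_neq0.
- move=> i j a; rewrite mulrACA Hy /quot_y.
  by field; rewrite !w0.
Qed.

Lemma invariant_eq1 i (F : gT -> k) : (forall a, F (a * x i)%g = F a) ->
  (forall a, e i a = 0 -> F a = 1) -> forall a, F a = 1.
Proof.
move=> Fx F0 a; have FX j : F (a * x i ^+ j)%g = F a.
  by elim: j => [|j IH]; rewrite ?expg0 ?mulg1 // expgSr mulgA Fx.
rewrite -(FX (m i - e i a)%N); apply: F0.
rewrite (coordM D) (coord_genX D) eqxx modnDmr subnKC ?modnn //.
exact: ltnW (coord_lt D i a).
Qed.

(** Functions are integrated along one cycle at a time, starting from the last
    factor.  If only the factors up to q contribute, a w_q equal to 1 off
    the slice of coordinate 0 removes z_q; then the products of the y_iq along the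
    cycle of x_q define w_i that remove all y_iq.  The closedness relations
    show that factors above q stay trivial under both steps. *)
Lemma closed2_exact_rec p z y : closed2 z y ->
  (forall i : 'I_n, (p <= i)%N -> forall a, z i a = 1) ->
  (forall i j : 'I_n, (p <= i)%N -> forall a, y i j a = 1) ->
  exists w, primitive1 w z y.
Proof.
elim: p z y => [|p IH] z y cl zp yp.
  exists (fun _ _ => 1); split=> [i a|i a|i j a]; first exact: oner_neq0.
  - by rewrite /orbit_prod big1 ?zp.
  - by rewrite yp ?mul1r.
have [np|pn] := leqP n p.
  by apply: (IH z y cl) => [i|i j] pi; [apply: zp|apply: yp];
    have := leq_trans np pi; rewrite leqNgt ltn_ord.
pose q := Ordinal pn.
have neq_q (i : 'I_n) : (p < i)%N -> q != i.
  by move=> pi; apply: contraTneq pi => <-; rewrite ltnn.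
have anti1 z' y' (cl' : closed2 z' y') (i j : 'I_n) a :
    y' i j a = 1 -> y' j i a = 1.
  by move=> y1; have := closed_anti cl' i j a; rewrite y1 mul1r.
(* Since z_q is invariant under x_q, it is the norm of its restriction to a
   slice. *)
pose w i a := if (i == q) && (e q a == 0%N) then z q a else 1.
have w0 i a : w i a != 0.
  by rewrite /w; case: ifP => _; [apply: closed_z0 cl _ _|apply: oner_neq0].
have cl1 := closed2_quot w0 cl.
set z1 := quot_z z w in cl1; set y1 := quot_y y w in cl1.
suff [w1 H1] : exists w1, primitive1 w1 z1 y1.
  by exists (fun i a => w i a * w1 i a); apply: primitive1_mul.
have z1q a : z1 q a = 1.
  move: a; apply: (@invariant_eq1 q) => a.
    rewrite /z1 /quot_z orbit_prod_shift (closed_zy cl).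
    rewrite [orbit_prod q _ a]big1 ?mulr1 //.
    by move=> j _; apply: closed_diag cl _ _.
  move=> ea; rewrite /z1 /quot_z.
  rewrite [orbit_prod _ _ _](bigD1 (Ordinal (coord_gt0 D q))) //=.
  rewrite mulg1 /w eqxx ea /= big1 ?mulr1 ?divff ?(closed_z0 cl) // => j nj.
  rewrite (coordM D) (coord_genX D) eqxx ea add0n modn_mod modn_small //.
  by rewrite ifN //; apply: contraNneq nj => j0; apply/eqP/val_inj.
have w_gt (i j : 'I_n) a : (p < i)%N -> w j (a * x i)%g = w j a.
  move=> pi; rewrite /w (coord_other D) ?neq_q // (closed_zy cl).
  by rewrite [orbit_prod _ _ _]big1 ?mulr1 // => l _; apply: yp.
have w_gt1 (i : 'I_n) a : (p < i)%N -> w i a = 1.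
  by move=> pi; rewrite /w eq_sym (negPf (neq_q i pi)).
have z1p (i : 'I_n) a : (p <= i)%N -> z1 i a = 1.
  rewrite leq_eqVlt => /orP[/eqP pi|pi]; last first.
    by rewrite /z1 /quot_z zp // [orbit_prod _ _ _]big1 ?divr1 // => j _; apply: w_gt1.
  by rewrite (_ : i = q) //; apply: val_inj.
have y1p (i j : 'I_n) a : (p < i)%N -> y1 i j a = 1.
  by move=> pi; rewrite /y1 /quot_y yp // !(w_gt1 i) // w_gt // !mulr1 mul1r divff.
(* The product of y_iq from a to the end of its x_q-cycle; it is well defined
   around the cycle because z_q = 1 makes the full product trivial. *)
pose w1 i a := \prod_(j < m q - e q a) y1 i q (a * x q ^+ j)%g.
have w10 i a : w1 i a != 0 by apply/prodf_neq0 => j _; apply: closed_y0 cl1 _ _ _.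
have cl2 := closed2_quot w10 cl1.
set z2 := quot_z z1 w1 in cl2; set y2 := quot_y y1 w1 in cl2.
suff [w2 H2] : exists w2, primitive1 w2 z2 y2.
  by exists (fun i a => w1 i a * w2 i a); apply: primitive1_mul.
have w1p (i : 'I_n) a : (p <= i)%N -> w1 i a = 1.
  rewrite leq_eqVlt => /orP[/eqP pi|pi]; rewrite /w1 big1 // => j _.
    by rewrite (_ : i = q) ?(closed_diag cl1) //; apply: val_inj.
  exact: y1p.
have w1_step i a : w1 i a = y1 i q a * w1 i (a * x q)%g.
  rewrite /w1 (coord_step D); have := coord_lt D q a.
  rewrite leq_eqVlt => /orP[/eqP eS|lt].
    have -> : (m q - e q a = 1)%N by rewrite -eS subSnn.
    rewrite eS modnn subn0 big_ord1 mulg1.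
    have := closed_zy cl1 q i (a * x q)%g; rewrite !z1q mul1r /orbit_prod => <-.
    by rewrite mulr1.
  rewrite modn_small // -(subnSK (ltnW lt)) big_ord_recl expg0 mulg1.
  by congr (_ * _); apply: eq_bigr => j _; rewrite expgS mulgA.
have y2q i a : y2 i q a = 1.
  rewrite /y2 /quot_y !(w1p q) // !mul1r (w1_step i a).
  by field; rewrite w10 (closed_y0 cl1).
apply: (IH _ _ cl2) => [i pi a|i j].
  rewrite /z2 /quot_z z1p // [orbit_prod _ _ _]big1 ?divr1 // => j _.
  by rewrite w1p.
rewrite leq_eqVlt => /orP[/eqP pi|pi] a.
  rewrite (_ : i = q); first exact: anti1 cl2 _ _ _ (y2q _ _).
  exact: val_inj.
have yq l b : y1 l q (b * x i)%g = y1 l q b.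
  have yi v c : y1 v i c = 1 by apply: anti1 cl1 _ _ _ _; apply: y1p.
  by have := closed_yy cl1 l q i b; rewrite !yi !(y1p i) // !mulr1.
have w1i : w1 j (a * x i)%g = w1 j a.
  rewrite /w1 (coord_other D) ?neq_q //; apply: eq_bigr => l _.
  by rewrite -mulgA (mulC (x i)) mulgA yq.
by rewrite /y2 /quot_y y1p // w1i !(w1p i) ?(ltnW pi) // mulr1 mul1r divff.
Qed.

Lemma closed2_exact z y : closed2 z y -> exists w, primitive1 w z y.
Proof.
move=> cl; apply: (@closed2_exact_rec n) => // i *;
  by have := ltn_ord i; rewrite ltnNge => /negP.
Qed.

End Acyclicity.

(** * Splitting the extension *)

Section OrbitMap.
Variables (gT : finGroupType) (n : nat) (m : 'I_n -> nat).
Variables (x : 'I_n -> gT) (e : 'I_n -> gT -> nat).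
Hypothesis D : cyclic_coordinates m x e.
Variables (T : Type) (R : T -> T -> Prop) (L : 'I_n -> T -> T) (t0 : T).
Hypothesis Rrefl : forall t, R t t.
Hypothesis Rtrans : forall t u v, R t u -> R u v -> R t v.
Hypothesis LR : forall i t u, R t u -> R (L i t) (L i u).
Hypothesis LC : forall i j t, R (L i (L j t)) (L j (L i t)).
Hypothesis LX : forall i t, R (iter (m i) (L i) t) t.

Definition orbit_map (b : gT) : T :=
  foldr (fun i t => iter (e i b) (L i) t) t0 (enum 'I_n).

Lemma orbit_map1 : orbit_map 1%g = t0.
Proof.
rewrite /orbit_map; elim: (enum _) => //= i r ->.
by rewrite (coord1 D).
Qed.

(** Commuting operators of orders m_i, up to the relation R, define an action
    of G, and [orbit_map] is the orbit map of [t0]: multiplying by x_i raises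
    the exponent of L_i by one, with a wrap-around absorbed by the order. *)
Lemma orbit_map_equivariant i b : R (L i (orbit_map b)) (orbit_map (x i * b)%g).
Proof.
have iterR c j t u : R t u -> R (iter c (L j) t) (iter c (L j) u).
  by move=> Rtu; elim: c => //= c IH; apply: LR.
have iterC c j t : R (L i (iter c (L j) t)) (iter c (L j) (L i t)).
  elim: c => [|c IH] /=; first exact: Rrefl.
  by apply: Rtrans (LC _ _ _) _; apply: LR.
rewrite /orbit_map (coord_mulC D (x i)).
have : i \in enum 'I_n by rewrite mem_enum.
move: (enum_uniq 'I_n).
elim: (enum _) => //= j r IH /andP[jr ur]; rewrite inE => ir.
have [ij|ij] := eqVneq i j.
  rewrite -ij (coord_step D).
  have -> : foldr (fun l t => iter (e l (b * x i)%g) (L l) t) t0 r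
          = foldr (fun l t => iter (e l b) (L l) t) t0 r.
    rewrite -ij in jr; elim: r jr {IH ir ur} => //= l r IH.
    rewrite inE negb_or => /andP[il ir]; rewrite IH // (coord_other D) //.
    by rewrite eq_sym.
  rewrite -iterS; have := coord_lt D i b; rewrite leq_eqVlt => /orP[/eqP eS|lt].
    by rewrite eS modnn; apply: LX.
  by rewrite modn_small.
rewrite (coord_other D) 1?eq_sym //; apply: Rtrans (iterC _ _ _) _.
by apply: iterR; apply: IH => //; rewrite (negPf ij) in ir.
Qed.

End OrbitMap.

Section Trivialization.
Variables (k : fieldType) (gT : finGroupType) (f : {ffun gT * gT * gT -> k}).
Hypothesis cf : cocycle3 f.

(** As a function of its first argument, f is modulo constants the coboundary of
    H.  Dividing by this coboundary leaves a cocycle W(b, c) independent of the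
    first argument, and the cocycle identity makes it the coboundary of
    (b, c) |-> W(1, c). *)
Lemma coboundary_of_left_primitive (H K : gT -> gT -> k) :
  (forall b a, H b a != 0) -> (forall b c, K b c != 0) ->
  (forall a b c, H b a * H c (a * b)%g * f (a, b, c) = K b c * H (b * c)%g a) ->
  exists2 h, cochain2 h & forall x, f x = coboundary2 h x.
Proof.
move=> H0 K0 E.
pose W b c := K b c / H c b.
have W0 b c : W b c != 0 by rewrite mulf_neq0 ?invr_eq0.
have fE a b c : f (a, b, c) = W b c * (H c b * H (b * c)%g a / (H c (a * b)%g * H b a)).
  rewrite /W; apply: (mulfI (mulf_neq0 (H0 b a) (H0 c (a * b)%g))).
  by rewrite E; field; rewrite !H0.
(* The part of f given by H satisfies the cocycle identity by itself and
   cancels. *)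
have WE b c d : W b (c * d)%g = W (b * c)%g d * W b c.
  case: cf => _ /(_ 1%g b c d); rewrite !fE !mul1g => F.
  have N : H d c * H (c * d)%g b * H (b * (c * d))%g 1%g
      / (H d (b * c)%g * H c b * H b 1%g) * W c d != 0.
    by rewrite !(mulf_neq0, invr_eq0).
  apply: (mulfI N); move: F; rewrite -!mulgA => F.
  transitivity (W b (c * d)%g *
    (H (c * d)%g b * H (b * (c * d))%g 1%g / (H (c * d)%g b * H b 1%g)) *
    (W c d * (H d c * H (c * d)%g b / (H d (b * c)%g * H c b)))).
    by field; rewrite !H0.
  rewrite F; by field; rewrite !H0.
exists [ffun p => H p.2 p.1 * W 1%g p.2].
  by move=> p; rewrite ffunE mulf_neq0.
move=> [[a b] c]; rewrite fE !ffunE /= (WE 1%g) mul1g.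
by field; rewrite !H0 !W0.
Qed.

End Trivialization.

Section Splitting.
Variables (k : fieldType) (gT : finGroupType) (n : nat) (m : 'I_n -> nat).
Variables (x : 'I_n -> gT) (e : 'I_n -> gT -> nat).
Hypothesis D : cyclic_coordinates m x e.
Variable f : {ffun gT * gT * gT -> k}.
Hypothesis cf : cocycle3 f.
Variables (X : 'I_n -> gT -> k) (u : 'I_n -> 'I_n -> k).
Hypothesis X0 : forall i a, X i a != 0.
Hypothesis u0 : forall i j, u i j != 0.
Hypothesis XN : forall i a,
  orbit_prod m x i (X i) a * normf f (m i) (x i) a = 1.
Hypothesis XC : forall i j a, X i a * X j (a * x i)%g * f (a, x i, x j) =
  u i j * (X j a * X i (a * x j)%g * f (a, x j, x i)).
Let nz := cocycle3_neq0 cf.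
Let mulC := coord_mulC D.

(** Left multiplication, in the extension, by the lift (X_i, x_i) of x_i.  The
    extension is a group only modulo constants, whence [eq_upto_const]; acting
    on pairs avoids forming the quotient. *)
Definition lift_act (i : 'I_n) (t : (gT -> k) * gT) : (gT -> k) * gT :=
  (fun a => X i a * t.1 (a * x i)%g * f (a, x i, t.2), (x i * t.2)%g).

Definition eq_upto_const (t t' : (gT -> k) * gT) : Prop :=
  t.2 = t'.2 /\ exists2 c, c != 0 & forall a, t.1 a = c * t'.1 a.

Lemma eq_upto_const_refl t : eq_upto_const t t.
Proof. by split=> //; exists 1; rewrite ?oner_neq0 // => a; rewrite mul1r. Qed.

Lemma eq_upto_const_trans t t' t'' :
  eq_upto_const t t' -> eq_upto_const t' t'' -> eq_upto_const t t''.
Proof.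
move=> [E [c c0 Ec]] [E' [c' c'0 Ec']]; split; first by rewrite E.
by exists (c * c'); rewrite ?mulf_neq0 // => a; rewrite Ec Ec' mulrA.
Qed.

Lemma lift_act_congr i t t' :
  eq_upto_const t t' -> eq_upto_const (lift_act i t) (lift_act i t').
Proof.
move=> [E [c c0 Ec]]; split; first by rewrite /= E.
by exists c => // a; rewrite /= E Ec; ring.
Qed.

Lemma lift_actC i j t :
  eq_upto_const (lift_act i (lift_act j t)) (lift_act j (lift_act i t)).
Proof.
case: t => Y c; split=> /=; first by rewrite !mulgA (mulC (x i)).
exists (u i j * (f (x i, x j, c) / f (x j, x i, c))) => [|a].
  by rewrite !(mulf_neq0, invr_eq0).
rewrite !(cocycle3_mull cf a) -!mulgA (mulC (x j) (x i)).
transitivity (X i a * X j (a * x i)%g * f (a, x i, x j) *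
  (Y (a * (x i * x j))%g * f (x i, x j, c) * f (a, (x i * x j)%g, c))).
  by field; rewrite !nz.
by rewrite XC; field; rewrite !nz.
Qed.

Lemma iter_lift_act j i t :
  (iter j (lift_act i) t).2 = (x i ^+ j * t.2)%g /\
  forall a, (iter j (lift_act i) t).1 a =
    \prod_(l < j) X i (a * x i ^+ l)%g * t.1 (a * x i ^+ j)%g *
    \prod_(l < j) f (a * x i ^+ l, x i, x i ^+ (j - l.+1) * t.2)%g.
Proof.
elim: j => [|j [IH2 IH1]] /=.
  by rewrite mul1g; split=> // a; rewrite !big_ord0 expg0 mulg1 mul1r mulr1.
split=> [|a]; first by rewrite IH2 mulgA -expgS.
rewrite IH1 IH2 !big_ord_recl /= expg0 mulg1 subn1 /= expgS mulgA.
have -> : \prod_(l < j) X i (a * x i ^+ bump 0 l)%g =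
  \prod_(l < j) X i (a * x i * x i ^+ l)%g.
  by apply: eq_bigr => l _; rewrite expgS mulgA.
have -> : \prod_(l < j) f (a * x i ^+ bump 0 l, x i,
                           x i ^+ (j.+1 - (bump 0 l).+1) * t.2)%g =
  \prod_(l < j) f (a * x i * x i ^+ l, x i, x i ^+ (j - l.+1) * t.2)%g.
  by apply: eq_bigr => l _; rewrite expgS mulgA.
ring.
Qed.

Lemma lift_actX i t : eq_upto_const (iter (m i) (lift_act i) t) t.
Proof.
have [E2 E1] := iter_lift_act (m i) i t; split.
  by rewrite E2 (coord_order D) mul1g.
exists (\prod_(l < m i) f (x i ^+ l, x i, x i ^+ (m i - l.+1) * t.2)%g).
  by apply/prodf_neq0 => l _; apply: nz.
move=> a; rewrite E1 (coord_order D) mulg1.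
(* The cocycle identity at (a, x_i ^ l, x_i, _) isolates [normf]; what depends
   on both a and the second component telescopes. *)
pose V y : k := f (a, y, y^-1 * t.2)%g.
have -> : \prod_(l < m i) f (a * x i ^+ l, x i, x i ^+ (m i - l.+1) * t.2)%g =
  \prod_(l < m i) f (x i ^+ l, x i, x i ^+ (m i - l.+1) * t.2)%g *
  normf f (m i) (x i) a.
  have V0 : \prod_(l < m i) V (x i ^+ l)%g != 0 by apply/prodf_neq0 => l _; apply: nz.
  transitivity (\prod_(l < m i) f (x i ^+ l, x i, x i ^+ (m i - l.+1) * t.2)%g *
    normf f (m i) (x i) a *
    (\prod_(l < m i) V (x i ^+ l.+1)%g / \prod_(l < m i) V (x i ^+ l)%g)); last first.
    by rewrite (prod_cycle_shift _ (coord_order D i)) divff ?mulr1.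
  rewrite -prodf_div /normf -!big_split /=; apply: eq_bigr => l _.
  have xl : (x i ^+ (m i - l.+1) = (x i ^+ l.+1)^-1)%g.
    apply: (mulIg (x i ^+ l.+1)%g).
    by rewrite -expgD subnK ?ltn_ord // mulVg (coord_order D).
  have xS : (x i * ((x i ^+ l.+1)^-1 * t.2) = (x i ^+ l)^-1 * t.2)%g.
    by rewrite expgSr invMg !mulgA mulgV mul1g.
  rewrite (cocycle3_mull cf) /V xl xS -expgSr.
  by field; rewrite !nz.
have := XN i a; rewrite /orbit_prod => E.
by rewrite -[RHS]mulr1 -[X in _ = _ * X]E; ring.
Qed.

(** The base point is the unit of the extension modulo constants, because
    f(a, 1, c) = f(1, 1, c) f(a, 1, 1). *)
Definition lift_section : gT -> (gT -> k) * gT :=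
  orbit_map e lift_act (fun a => (f (a, 1, 1)%g)^-1, 1%g).

Lemma lift_section_step i b :
  eq_upto_const (lift_act i (lift_section b)) (lift_section (x i * b)%g).
Proof.
apply: (orbit_map_equivariant D).
- exact: eq_upto_const_refl.
- exact: eq_upto_const_trans.
- exact: lift_act_congr.
- exact: lift_actC.
- exact: lift_actX.
Qed.

Lemma lift_section2 b : (lift_section b).2 = b.
Proof.
elim/(coord_ind D): b => [|i b IH].
  by rewrite /lift_section (orbit_map1 D).
by case: (lift_section_step i b) => /= <- _; rewrite IH.
Qed.

Lemma lift_section_neq0 b a : (lift_section b).1 a != 0.
Proof.
elim/(coord_ind D): b a => [|i b IH] a.
  by rewrite /lift_section (orbit_map1 D) /= invr_eq0.
case: (lift_section_step i b) => _ [c c0 /(_ a) /= E].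
have : X i a * (lift_section b).1 (a * x i)%g * f (a, x i, (lift_section b).2) != 0.
  by rewrite !mulf_neq0.
by rewrite E mulf_eq0 (negPf c0).
Qed.

(** The section is multiplicative: for generators this is equivariance of the
    orbit map, and the general case follows by induction on b, the cocycle
    identity being associativity up to constants. *)
Lemma lift_section_mult b c : exists2 K, K != 0 & forall a,
  (lift_section b).1 a * (lift_section c).1 (a * b)%g * f (a, b, c) =
  K * (lift_section (b * c)%g).1 a.
Proof.
elim/(coord_ind D): b c => [|i b IH] c.
  exists (f (1, 1, c)%g) => // a.
  have E : f (a, 1, c)%g = f (1, 1, c)%g * f (a, 1, 1)%g.
    have := cocycle3_mull cf a 1%g 1%g c; rewrite mulg1 !mul1g => ->.
    by field; rewrite nz.
  rewrite mulg1 mul1g {1}/lift_section (orbit_map1 D) /= E.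
  by field; rewrite nz.
have [K K0 EK] := IH c.
case: (lift_section_step i b) => _ [d d0 /= Ed].
case: (lift_section_step i (b * c)%g) => _ [d' d'0 /= Ed'].
rewrite !lift_section2 in Ed Ed'.
exists (d^-1 * K * d' / f (x i, b, c)).
  by rewrite !mulf_neq0 ?invr_eq0.
move=> a; apply: (mulfI d0).
have := EK (a * x i)%g; rewrite (cocycle3_mull cf) => {}EK.
transitivity ((d * (lift_section (x i * b)%g).1 a)
  * ((lift_section c).1 (a * (x i * b))%g * f (a, (x i * b)%g, c))); first by ring.
transitivity ((f (x i, b, c))^-1 * K * (d' * (lift_section (x i * (b * c))%g).1 a));
  last by rewrite -(mulgA (x i)); field; rewrite nz d0.
rewrite -Ed -Ed' (mulgA a).
transitivity ((f (x i, b, c))^-1 * X i a * f (a, x i, (b * c)%g) *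
  (K * (lift_section (b * c)%g).1 (a * x i)%g)); last by ring.
by rewrite -EK; field; rewrite !nz.
Qed.

Lemma cocycle3_split_coboundary :
  exists2 h, cochain2 h & forall x, f x = coboundary2 h x.
Proof.
have [K HK] := fin_all_exists (fun p : gT * gT =>
  let: ex_intro2 K K0 EK := lift_section_mult p.1 p.2 in ex_intro _ K (conj K0 EK)).
apply: (coboundary_of_left_primitive cf (H := fun b a => (lift_section b).1 a)
   (K := fun b c => K (b, c))).
- exact: lift_section_neq0.
- by move=> b c; case: (HK (b, c)).
- by move=> a b c; case: (HK (b, c)).
Qed.

End Splitting.

(** * A criterion for coboundaries *)

Section Criterion.
Variables (k : fieldType) (gT : finGroupType) (n : nat) (m : 'I_n -> nat).
Variables (x : 'I_n -> gT) (e : 'I_n -> gT -> nat).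
Hypothesis D : cyclic_coordinates m x e.
Variable f : {ffun gT * gT * gT -> k}.
Hypothesis cf : cocycle3 f.

(** Only the classes of the commutators modulo constants matter, so that the
    y_ij may be multiplied by an alternating family of constants u_ij; this
    changes the slants by the powers u_hi ^ m_i. *)
Lemma coboundary_criterion (u : 'I_n -> 'I_n -> k) :
  (forall i, u i i = 1) -> (forall i j, u i j * u j i = 1) ->
  (forall i h, slant f (m i) (x i) (x h) = u h i ^+ m i) ->
  (forall i j l, alt3 f (x i) (x j) (x l) = 1) ->
  exists2 h, cochain2 h & forall p, f p = coboundary2 h p.
Proof.
move=> uii uV Hslant Halt; have nz := cocycle3_neq0 cf.
have mulC := coord_mulC D.
have u0 i j : u i j != 0.
  by apply: contra_eq_neq (uV i j) => ->; rewrite mul0r eq_sym oner_eq0.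
pose z i a := normf f (m i) (x i) a.
pose y i j a := u i j * commf f (x i) (x j) a.
have cl : closed2 m x z y.
  split.
  - by move=> i a; apply: normf_neq0.
  - by move=> i j a; rewrite mulf_neq0 ?commf_neq0.
  - by move=> i j a; rewrite /y /commf -[RHS](uV i j); field; rewrite !nz.
  - by move=> i a; rewrite /y uii mul1r /commf divff.
  - move=> i h a; rewrite /z (normf_shift mulC cf) ?(coord_order D) // Hslant.
    rewrite /orbit_prod /y [in RHS]big_split /= prodr_const card_ord; ring.
  - move=> i j l a; have := commf_shift mulC cf (x i) (x j) (x l) a.
    rewrite Halt mul1r /y => E.
    transitivity (u i j * u j l * u l i * (commf f (x i) (x j) (a * x l)%g *
      commf f (x j) (x l) (a * x i)%g * commf f (x l) (x i) (a * x j)%g)).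
      by ring.
    by rewrite E; ring.
have [w [w0 wz wy]] := closed2_exact D cl.
apply: (@cocycle3_split_coboundary _ _ _ _ _ _ D _ cf (fun i a => (w i a)^-1)
  (fun i j => (u i j)^-1)).
- by move=> i a; rewrite invr_eq0.
- by move=> i j; rewrite invr_eq0.
- move=> i a.
  by rewrite /orbit_prod prodfV -[\prod_(_ < _) _]/(orbit_prod m x i (w i) a)
    wz mulVf ?normf_neq0.
- move=> i j a; have := wy i j a; rewrite /y /commf => E.
  have -> : (w i a)^-1 * (w j (a * x i)%g)^-1 = (w j (a * x i)%g * w i a)^-1.
    by rewrite invfM mulrC.
  by rewrite E; field; rewrite !nz !w0 u0.
Qed.

End Criterion.

(** * The detecting numbers on coboundaries, and their symmetries *)

Section Coboundary.
Variables (k : fieldType) (gT : finGroupType).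
Hypothesis mulC : commutative (@mulg gT).
Implicit Types f : {ffun gT * gT * gT -> k}.

Lemma slantM f f1 f2 m g h : (forall p, f p = f1 p * f2 p) ->
  slant f m g h = slant f1 m g h * slant f2 m g h.
Proof.
move=> E; rewrite /slant -big_split; apply: eq_bigr => j _ /=.
by rewrite !E invfM; ring.
Qed.

Lemma alt3M f f1 f2 a b c : (forall p, f p = f1 p * f2 p) ->
  alt3 f a b c = alt3 f1 a b c * alt3 f2 a b c.
Proof. by move=> E; rewrite /alt3 !E !invfM; ring. Qed.

(** The slant product of a coboundary by g' is the coboundary of
    y |-> h (y, g') / h (g', y), and telescopes along the cycle of g up to the
    value of this cochain at g. *)
Lemma slant_coboundary (h : {ffun gT * gT -> k}) m g g' : cochain2 h ->
  (g ^+ m = 1)%g ->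
  slant (coboundary2 h) m g g' = (h (g, g') / h (g', g)) ^+ m.
Proof.
move=> h0 gm.
pose P y : k := h (g', y) / h (y, g').
have P0 : \prod_(j < m) P (g ^+ j)%g != 0.
  by apply/prodf_neq0 => j _; rewrite mulf_neq0 ?invr_eq0 ?h0.
rewrite -[RHS]mulr1 -[X in _ = _ * X](divff P0).
rewrite -[X in _ = _ * (X / _)](prod_cycle_shift P gm) -prodf_div.
rewrite -[X in _ = X ^+ _ * _]/(_ / _) -[m in _ ^+ m]card_ord -prodr_const -big_split.
apply: eq_bigr => j _; rewrite !ffunE /P /= (mulC g' g) (mulC g' (g ^+ j)%g) -expgSr.
by field; rewrite !h0.
Qed.

Lemma alt3_coboundary (h : {ffun gT * gT -> k}) a b c : cochain2 h ->
  alt3 (coboundary2 h) a b c = 1.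
Proof.
move=> h0; rewrite /alt3 !ffunE (mulC b a) (mulC c a) (mulC c b).
by field; rewrite !h0.
Qed.

Lemma alt3_swap12 f a b c : alt3 f b a c = (alt3 f a b c)^-1.
Proof. by rewrite /alt3 invf_div; congr (_ / _); ring. Qed.

Lemma alt3_rot f a b c : alt3 f b c a = alt3 f a b c.
Proof. by rewrite /alt3; congr (_ / _); ring. Qed.

Lemma alt3_diag f a c : (forall p, f p != 0) -> alt3 f a a c = 1.
Proof. by move=> nz; rewrite /alt3; field; rewrite !nz. Qed.

Lemma alt3_eq1 f n (x : 'I_n -> gT) : (forall p, f p != 0) ->
  (forall r s t : 'I_n, (r < s)%N -> (s < t)%N -> alt3 f (x t) (x s) (x r) = 1) ->
  forall i j l, alt3 f (x i) (x j) (x l) = 1.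
Proof.
move=> nz H.
have W (i j l : 'I_n) : (j <= i)%N -> (l <= i)%N -> alt3 f (x i) (x j) (x l) = 1.
  rewrite leq_eqVlt => /orP[/eqP/val_inj -> _|ji]; first exact: alt3_diag.
  rewrite leq_eqVlt => /orP[/eqP/val_inj ->|li].
    by rewrite -alt3_rot -alt3_rot alt3_diag.
  have [lj|jl|/val_inj ->] := ltngtP l j.
  - exact: H.
  - by rewrite -alt3_rot alt3_swap12 -alt3_rot -alt3_rot H // invr1.
  - by rewrite -alt3_rot alt3_diag.
move=> i j l; have [ji|/ltnW ij] := leqP j i; have [li|/ltnW il] := leqP l i.
- exact: W.
- by rewrite -alt3_rot -alt3_rot W // (leq_trans ji).
- by rewrite -alt3_rot W // (leq_trans li).
have [lj|/ltnW jl] := leqP l j.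
  by rewrite -alt3_rot W.
by rewrite -alt3_rot -alt3_rot W.
Qed.

End Coboundary.

Section Quotient.
Variables (k : fieldType) (gT : finGroupType).
Implicit Types f : {ffun gT * gT * gT -> k}.

Lemma cocycle3_div f1 f2 : cocycle3 f1 -> cocycle3 f2 ->
  cocycle3 [ffun p => f1 p / f2 p].
Proof.
move=> [n1 c1] [n2 c2]; split=> [p|a b c d].
  by rewrite ffunE mulf_neq0 ?invr_eq0.
rewrite !ffunE mulf_div c1 c2.
by field; rewrite !n2.
Qed.

End Quotient.

(** * The standard cocycles *)

Section CocycleFunctions.
Variables (k : fieldType) (gT : finGroupType).

Definition cocycle_fun (c : gT -> gT -> gT -> k) : Prop :=
  forall a b d w, c a b (d * w)%g * c (a * b)%g d w =
    c b d w * c a (b * d)%g w * c a b d.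

Lemma cocycle_funM c c' : cocycle_fun c -> cocycle_fun c' ->
  cocycle_fun (fun u v w => c u v w * c' u v w).
Proof. by move=> H H' a b d w; rewrite mulrACA H H'; ring. Qed.

Lemma cocycle_fun_prod (I : Type) (r : seq I) (P : pred I)
    (c : I -> gT -> gT -> gT -> k) : (forall i, P i -> cocycle_fun (c i)) ->
  cocycle_fun (fun u v w => \prod_(i <- r | P i) c i u v w).
Proof.
move=> H a b d w; rewrite -!big_split; apply: eq_bigr => i Pi /=.
exact: H.
Qed.

End CocycleFunctions.

Section StandardCocycles.
Variables (k : fieldType) (gT : finGroupType) (n : nat) (m : 'I_n -> nat).
Variables (x : 'I_n -> gT) (e : 'I_n -> gT -> nat).
Hypothesis D : cyclic_coordinates m x e.

Definition carry (s : 'I_n) (v w : gT) : nat := ((e s v + e s w) %/ m s)%N.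

(** The carry is the 2-cocycle of the extension of Z/m_s by Z: both sides count
    the multiples of m_s lost when e b + e c + e d is reduced. *)
Lemma carry_cocycle s b c d :
  (carry s b (c * d)%g + carry s c d = carry s (b * c)%g d + carry s b c)%N.
Proof.
have E v w : (carry s v w * m s + e s (v * w)%g = e s v + e s w)%N.
  by rewrite (coordM D) -divn_eq.
have := E b (c * d)%g; have := E c d; have := E (b * c)%g d; have := E b c.
rewrite mulgA => H1 H2 H3 H4.
have m0 := coord_gt0 D s.
apply/eqP; rewrite -(eqn_pmul2r m0) !mulnDl; apply/eqP.
move: H1 H2 H3 H4; rewrite /carry.
move: (e s b) (e s c) (e s d) (_ * m s)%N (_ * m s)%N (_ * m s)%N (_ * m s)%N.
by move: (e s (b * c)%g) (e s (c * d)%g) (e s (b * c * d)%g) => *; lia.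
Qed.

Lemma carry_gen l q o : q != o -> carry l (x q) (x o) = 0%N.
Proof.
move=> qo; rewrite /carry !(coord_gen D) divn_small //.
have [ql|_] := eqVneq q l.
  by rewrite -ql eq_sym (negPf qo) mod0n addn0 ltn_mod (coord_gt0 D).
by rewrite mod0n add0n ltn_mod (coord_gt0 D).
Qed.

Lemma root_coordM (z : k) i a b : z ^+ m i = 1 ->
  z ^+ e i (a * b)%g = z ^+ e i a * z ^+ e i b.
Proof. by move=> z1; rewrite (coordM D) expr_mod // exprD. Qed.

(** The cup product of a character of G with the carry cocycle. *)
Lemma char_carry_cocycle (z : k) q s t : z ^+ m t = 1 ->
  cocycle_fun (fun u v w => z ^+ (q * e t u * carry s v w)).
Proof.
move=> z1 a b c d /=.
have E u v w : z ^+ (q * e t u * carry s v w) = (z ^+ (q * carry s v w)) ^+ e t u.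
  by rewrite -exprM mulnAC.
rewrite !E root_coordM; last by rewrite exprAC z1 expr1n.
rewrite mulrA -exprMn -exprD -mulnDr carry_cocycle mulnDr exprD exprMn.
ring.
Qed.

(** The cup product of three characters of G. *)
Lemma trilinear_cocycle (z : k) q r s t :
  z ^+ m r = 1 -> z ^+ m s = 1 -> z ^+ m t = 1 ->
  cocycle_fun (fun u v w => z ^- (q * e r w * e s v * e t u)).
Proof.
move=> zr zs zt a b c d /=.
have root l q' : z ^+ m l = 1 -> (z ^+ q') ^+ m l = 1.
  by move=> z1; rewrite exprAC z1 expr1n.
have Er u v w w' : z ^+ (q * e r (w * w')%g * e s v * e t u) =
    z ^+ (q * e r w * e s v * e t u) * z ^+ (q * e r w' * e s v * e t u).
  have E y : (q * e r y * e s v * e t u = q * e s v * e t u * e r y)%N by lia.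
  by rewrite !E !(exprM _ (q * e s v * e t u)) root_coordM // root.
have Es u v v' w : z ^+ (q * e r w * e s (v * v')%g * e t u) =
    z ^+ (q * e r w * e s v * e t u) * z ^+ (q * e r w * e s v' * e t u).
  have E y : (q * e r w * e s y * e t u = q * e r w * e t u * e s y)%N by lia.
  by rewrite !E !(exprM _ (q * e r w * e t u)) root_coordM // root.
have Et u u' v w : z ^+ (q * e r w * e s v * e t (u * u')%g) =
    z ^+ (q * e r w * e s v * e t u) * z ^+ (q * e r w * e s v * e t u').
  by rewrite !(exprM _ (q * e r w * e s v)) root_coordM // root.
by rewrite Er Es Et !invfM; ring.
Qed.

Variables (zeta : nat -> k) (F : {ffun gT * gT * gT -> k}).
Hypothesis zetaP : forall d : nat, (0 < d)%N -> d.-primitive_root (zeta d).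
Variable a : cocycle_index n.
Hypothesis FE : forall u v w, F (u, v, w) =
  Phi_exponents zeta m a (e^~ u) (e^~ v) (e^~ w).

Let zeta_root l : zeta (m l) ^+ m l = 1.
Proof. exact/prim_expr_order/zetaP/(coord_gt0 D). Qed.

Lemma zeta_gcd3 r s t l : l \in [:: r; s; t] ->
  zeta (gcdn (gcdn (m r) (m s)) (m t)) ^+ m l = 1.
Proof.
move=> lrst; set d := gcdn _ _.
have d0 : (0 < d)%N by rewrite !gcdn_gt0 (coord_gt0 D).
have /dvdnP[q ->] : (d %| m l)%N.
  move: lrst; rewrite !inE => /or3P[] /eqP->.
  - exact: dvdn_trans (dvdn_gcdl _ _) (dvdn_gcdl _ _).
  - exact: dvdn_trans (dvdn_gcdl _ _) (dvdn_gcdr _ _).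
  - exact: dvdn_gcdr.
by rewrite mulnC exprM (prim_expr_order (zetaP d0)) expr1n.
Qed.

Lemma Phi_neq0 p : F p != 0.
Proof.
have z0 d : (0 < d)%N -> zeta d != 0.
  move=> d0; apply: contra_eq_neq (prim_expr_order (zetaP d0)) => ->.
  by rewrite expr0n gtn_eqF // eq_sym oner_eq0.
case: p => [[u v] w]; rewrite FE /Phi_exponents !mulf_neq0 //.
- by apply/prodf_neq0 => l _; rewrite expf_neq0 // z0 ?(coord_gt0 D).
- apply/prodf_neq0 => s _; apply/prodf_neq0 => t _.
  by rewrite expf_neq0 // z0 ?(coord_gt0 D).
apply/prodf_neq0 => r _; apply/prodf_neq0 => s _; apply/prodf_neq0 => t _.
by rewrite invr_eq0 expf_neq0 // z0 // !gcdn_gt0 (coord_gt0 D).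
Qed.

Lemma Phi_normalized_cocycle : normalized_cocycle3 F.
Proof.
split; [split; first exact: Phi_neq0|].
  suff H : cocycle_fun (fun u v w => Phi_exponents zeta m a (e^~ u) (e^~ v) (e^~ w)).
    by move=> b c d w; rewrite !FE; apply: H.
  rewrite /Phi_exponents.
  apply: cocycle_funM.
    apply: cocycle_funM.
      apply: cocycle_fun_prod => l _.
      exact: char_carry_cocycle.
    apply: cocycle_fun_prod => s _.
    apply: cocycle_fun_prod => t _.
    exact: char_carry_cocycle.
  apply: cocycle_fun_prod => r _.
  apply: cocycle_fun_prod => s _.
  apply: cocycle_fun_prod => t _.
  by apply: trilinear_cocycle; apply: zeta_gcd3; rewrite !inE eqxx ?orbT.
move=> u w; rewrite FE /Phi_exponents.
have c0 l : ((e l 1%g + e l w) %/ m l = 0)%N.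
  by rewrite (coord1 D) divn_small // (coord_lt D).
rewrite big1 => [|l _]; last by rewrite c0 muln0.
rewrite big1 => [|s _]; last by rewrite big1 // => t _; rewrite c0 muln0.
rewrite big1 ?mulr1 // => r _; rewrite big1 // => s _; rewrite big1 // => t _.
by rewrite (coord1 D) muln0 mul0n expr0 invr1.
Qed.

(** Distinct generators never carry, and the trilinear factors only see triples
    of generators in decreasing order. *)
Lemma Phi_no_carry (p q o : 'I_n) c : q != o -> ~~ ((o < q) && (q < p))%N ->
  F (x p ^+ c, x q, x o)%g = 1.
Proof.
move=> qo oqp; rewrite FE /Phi_exponents.
have c0 l := carry_gen l qo; rewrite /carry in c0.
rewrite big1 => [|l _]; last by rewrite c0 muln0.
rewrite big1 => [|s _]; last by rewrite big1 // => t _; rewrite c0 muln0.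
rewrite big1 ?mulr1 // => r _; rewrite big1 // => s rs; rewrite big1 // => t st.
rewrite !(coord_gen D) (coord_genX D).
have [op|] := eqVneq o r; last by rewrite mod0n muln0 !mul0n expr0 invr1.
have [qp|] := eqVneq q s; last by rewrite mod0n muln0 !mul0n expr0 invr1.
have [pp|] := eqVneq p t; last by rewrite muln0 expr0 invr1.
by rewrite op qp pp rs st in oqp.
Qed.

Hypothesis adm : admissible_index m a.

(** Among the six orderings only (x_t, x_s, x_r) meets a trilinear factor.  If
    some m_l is 1, its generator has coordinate 0, but then the gcd is 1 and
    the index is 0. *)
Lemma alt3_Phi (r s t : 'I_n) : (r < s)%N -> (s < t)%N ->
  alt3 F (x t) (x s) (x r) =
  zeta (gcdn (gcdn (m r) (m s)) (m t)) ^- idx3 a r s t.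
Proof.
move=> rs st; rewrite /alt3.
have ne (i j : 'I_n) : (i < j)%N -> (i != j) * (j != i).
  by move=> ij; split; apply: contraTneq ij => ->; rewrite ltnn.
have rt := ltn_trans rs st.
have N (p q o : 'I_n) : q != o -> ~~ ((o < q) && (q < p))%N -> F (x p, x q, x o) = 1.
  by move=> qo oqp; rewrite -[x p]expg1 Phi_no_carry.
rewrite (N s r t) ?(N r t s) ?(N s t r) ?(N t r s) ?(N r s t)
  ?(ne _ _ rs) ?(ne _ _ st) ?(ne _ _ rt) //; try by lia.
rewrite !mulr1 divr1 FE /Phi_exponents.
have c0 l := carry_gen l (ne _ _ rs).2; rewrite /carry in c0.
rewrite big1 => [|l _]; last by rewrite c0 muln0.
rewrite big1 => [|s' _]; last by rewrite big1 // => t' _; rewrite c0 muln0.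
rewrite !mul1r (bigD1 r) //= [X in _ * X]big1 => [|r' r'r]; last first.
  rewrite big1 // => s' _; rewrite big1 // => t' _.
  by rewrite !(coord_gen D) eq_sym (negPf r'r) mod0n muln0 !mul0n expr0 invr1.
rewrite mulr1 (bigD1 s) //= [X in _ * X]big1 => [|s' /andP[_ s's]]; last first.
  rewrite big1 // => t' _.
  by rewrite !(coord_gen D) (eq_sym s) (negPf s's) mod0n muln0 !mul0n expr0 invr1.
rewrite mulr1 (bigD1 t) //= big1 => [|t' /andP[_ t't]]; last first.
  by rewrite !(coord_gen D) (eq_sym t) (negPf t't) mod0n muln0 expr0 invr1.
rewrite mulr1 !(coord_gen D) !eqxx.
have [_ _ /(_ r s t rs st)] := adm; set d := gcdn _ _ => ad.
have [d1|d1] := leqP d 1.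
  by have -> : idx3 a r s t = 0%N by lia.
have mod1 l : l \in [:: r; s; t] -> (true %% m l = 1)%N.
  move=> lrst; rewrite modn_small //.
  have := zeta_gcd3 lrst; rewrite -/d.
  case: (m l) (coord_gt0 D l) => [|[|ml]] // _ /eqP.
  by rewrite -(prim_order_dvd (zetaP (ltnW d1))) dvdn1; lia.
by rewrite !mod1 ?inE ?eqxx ?orbT // !muln1.
Qed.

(** The coordinate of the generator is 1 %% m_t, which is 0 when m_t = 1; but
    then zeta_1 = 1. *)
Lemma zeta_coord (t : 'I_n) q c :
  zeta (m t) ^+ (q * e t (x t) * c) = zeta (m t) ^+ (q * c).
Proof.
rewrite (coord_gen D) eqxx -mulnA mulnCA exprM.
by rewrite expr_mod // expr1.
Qed.

(** The trilinear factors vanish because their second and third arguments would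
    need different coordinates; only the carry at s, paired with the t-th
    coordinate, survives. *)
Lemma Phi_carry (s t : 'I_n) j :
  F (x t, x s ^+ j, x s)%g =
  (if s == t then zeta (m t) ^+ (idx1 a t * ((j %% m s + 1 %% m s) %/ m s))
   else if (s < t)%N then zeta (m t) ^+ (idx2 a s t * ((j %% m s + 1 %% m s) %/ m s))
   else 1).
Proof.
rewrite FE /Phi_exponents.
rewrite [X in _ * X]big1 ?mulr1 => [|r' _]; last first.
  rewrite big1 // => s' rs; rewrite big1 // => t' _.
  rewrite !(coord_gen D) (coord_genX D).
  have [sr|_] := eqVneq s r'; last by rewrite mod0n muln0 !mul0n expr0 invr1.
  rewrite ifN; first by rewrite muln0 !mul0n expr0 invr1.
  by rewrite sr; apply: contraTneq rs => ->; rewrite ltnn.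
have cE l : ((e l (x s ^+ j)%g + e l (x s)) %/ m l =
    if s == l then (j %% m s + 1 %% m s) %/ m s else 0)%N.
  rewrite !(coord_gen D) (coord_genX D); case: eqP => [->//|_].
  by rewrite mod0n div0n.
have et l : l != t -> e l (x t) = 0%N.
  by move=> lt; rewrite (coord_gen D) eq_sym (negPf lt) mod0n.
rewrite (bigD1 t) //= [X in _ * X * _]big1 => [|l lt]; last first.
  by rewrite et // muln0 mul0n.
rewrite mulr1 cE zeta_coord (bigD1 s) //=.
rewrite [X in _ * (_ * X)]big1 => [|s' s's]; last first.
  by rewrite big1 // => t' _; rewrite cE eq_sym (negPf s's) muln0.
have H : \prod_(t' < n | (s < t')%N) zeta (m t') ^+
     (idx2 a s t' * e t' (x t) * ((e s (x s ^+ j)%g + e s (x s)) %/ m s)) =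
   if (s < t)%N then zeta (m t) ^+ (idx2 a s t * ((j %% m s + 1 %% m s) %/ m s)) else 1.
  case: ifP => st; last first.
    rewrite big1 // => t' st'; rewrite et ?muln0 ?mul0n //.
    by apply: contraFneq st => <-.
  rewrite (bigD1 t) //= big1 => [|t' /andP[_ t't]]; last by rewrite et // muln0 mul0n.
  by rewrite mulr1 zeta_coord cE eqxx.
rewrite mulr1 H; case: eqP => [->|_]; last by rewrite muln0 mul1r.
by rewrite ltnn mulr1.
Qed.

Lemma slant_Phi_diag l : slant F (m l) (x l) (x l) = zeta (m l) ^+ idx1 a l.
Proof.
have [/(_ l) al _ _] := adm.
rewrite -(prod_carry _ al); apply: eq_bigr => j _.
by rewrite mulfK ?Phi_neq0 // Phi_carry eqxx.
Qed.

Lemma slant_Phi s t : s != t -> slant F (m s) (x s) (x t) =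
  if (s < t)%N then zeta (m t) ^+ idx2 a s t else 1.
Proof.
move=> st; have -> : slant F (m s) (x s) (x t) =
    \prod_(j < m s) F (x t, x s ^+ j, x s)%g.
  apply: eq_bigr => j _.
  rewrite !Phi_no_carry // 1?eq_sym // ?mulr1 ?divr1 //.
    by rewrite andbC; case: (ltngtP s t).
  by rewrite ltnn andbF.
under eq_bigr do rewrite Phi_carry (negPf st).
case: ifP => lst; last by rewrite big1.
have [_ /(_ s t lst) ast _] := adm.
rewrite prod_carry // (leq_trans ast) //.
by rewrite dvdn_leq ?dvdn_gcdl ?(coord_gt0 D).
Qed.

End StandardCocycles.

(** * Classification by the indices *)

Section Classification.
Variables (k : closedFieldType) (gT : finGroupType) (n : nat) (m : 'I_n -> nat).
Variables (x : 'I_n -> gT) (e : 'I_n -> gT -> nat).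
Hypothesis D : cyclic_coordinates m x e.
Variable zeta : nat -> k.
Hypothesis zetaP : forall d : nat, (0 < d)%N -> d.-primitive_root (zeta d).
Variable Ph : cocycle_index n -> {ffun gT * gT * gT -> k}.
Hypothesis PhE : forall a u v w, Ph a (u, v, w) =
  Phi_exponents zeta m a (e^~ u) (e^~ v) (e^~ w).
Let mulC := coord_mulC D.

Lemma eq_zeta_expr d i j : (0 < d)%N -> (i < d)%N -> (j < d)%N ->
  zeta d ^+ i = zeta d ^+ j -> i = j.
Proof.
move=> d0 id jd /eqP; rewrite (eq_prim_root_expr (zetaP d0)).
by rewrite !modn_small // => /eqP.
Qed.

(** For s < t, the pair of slants of the coboundary gives u with
    zeta ^ a_st = zeta ^ b_st * u ^ m_s and u ^ m_t = 1, so that a_st and b_st agree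
    modulo gcd(m_s, m_t). *)
Lemma cohomologous_Phi_eq a b h : admissible_index m a -> admissible_index m b ->
  cochain2 h -> (forall p, Ph a p = Ph b p * coboundary2 h p) -> Ph a = Ph b.
Proof.
move=> aa ab h0 E.
have m0 := coord_gt0 D.
have [[a1 a2 a3] [b1 b2 b3]] := (aa, ab).
have slE s t : slant (Ph a) (m s) (x s) (x t) = slant (Ph b) (m s) (x s) (x t)
    * (h (x s, x t) / h (x t, x s)) ^+ m s.
  by rewrite (slantM _ _ _ E) (slant_coboundary mulC _ h0) ?(coord_order D).
have E1 l : idx1 a l = idx1 b l.
  apply: (eq_zeta_expr (m0 l)); rewrite ?a1 ?b1 //.
  have := slE l l; rewrite divff ?h0 // expr1n mulr1.
  by rewrite !(slant_Phi_diag D zetaP (PhE _)).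
have E2 (s t : 'I_n) : (s < t)%N -> idx2 a s t = idx2 b s t.
  move=> st; have [u0 v0] := (h0 (x s, x t), h0 (x t, x s)).
  have nst : s != t by apply: contraTneq st => ->; rewrite ltnn.
  have := slE s t; have := slE t s.
  rewrite !(slant_Phi D zetaP (PhE _)) // 1?eq_sym // st ltnNge (ltnW st) /= mul1r.
  set u := h (x s, x t) / h (x t, x s).
  rewrite -[h (x t, x s) / _]invf_div -/u exprVn => /esym/(canRL invrK); rewrite invr1.
  case/(prim_rootP (zetaP (m0 t))) => i ->.
  rewrite -exprM -exprD => /eqP; rewrite (eq_prim_root_expr (zetaP (m0 t))) => /eqP.
  set d := gcdn (m s) (m t).
  have dt : (d %| m t)%N by apply: dvdn_gcdr.
  move/(congr1 (modn^~ d)); rewrite !modn_dvdm // -modnDmr.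
  have /dvdnP[q ->] : (d %| m s)%N by apply: dvdn_gcdl.
  by rewrite mulnA modnMl addn0 !modn_small ?a2 ?b2.
have E3 (r s t : 'I_n) : (r < s)%N -> (s < t)%N -> idx3 a r s t = idx3 b r s t.
  move=> rs st; have d0 : (0 < gcdn (gcdn (m r) (m s)) (m t))%N by rewrite !gcdn_gt0 m0.
  apply: (eq_zeta_expr d0); rewrite ?a3 ?b3 //.
  have := alt3M (x t) (x s) (x r) E.
  by rewrite (alt3_coboundary mulC) // mulr1 !(alt3_Phi D zetaP (PhE _)) // =>
    /invr_inj.
apply/ffunP => [[[u v] w]]; rewrite !PhE /Phi_exponents; congr (_ * _ * _).
- by apply: eq_bigr => l _; rewrite E1.
- by apply: eq_bigr => s _; apply: eq_bigr => t st; rewrite E2.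
apply: eq_bigr => r _; apply: eq_bigr => s rs; apply: eq_bigr => t st.
by rewrite E3.
Qed.

(** The pair (slant_st, slant_ts) = (b, b') can be moved to (zeta_q ^ a, 1) by
    a change of y_st: a q-th root of b' trivializes the second entry and
    turns the first one into a power zeta_q ^ c, and the remaining q-th roots
    of unity change c by multiples of p, hence by multiples of gcd(p, q) modulo
    q. *)
Lemma ex_normalizing_pair p q (b b' : k) : (0 < p)%N -> (0 < q)%N ->
  b ^+ q * b' ^+ p = 1 ->
  exists av : nat * k, [/\ (av.1 < gcdn p q)%N, zeta q ^+ av.1 = b * av.2 ^+ p
    & av.2 ^+ q = b'].
Proof.
move=> p0 q0 bb; have [v vq] := ex_root b' q0.
have /(prim_rootP (zetaP q0))[c cE] : (b * v ^+ p) ^+ q = 1.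
  by rewrite exprMn exprAC vq.
have [A _ /dvdnP[j Aj]] := Bezoutl p q0.
set d := gcdn p q; have d0 : (0 < d)%N by rewrite gcdn_gt0 p0.
rewrite gcdnC -/d in Aj.
exists ((c %% d)%N, v * zeta q ^+ (c %/ d * A)); split=> /=.
- by rewrite ltn_mod.
- rewrite exprMn mulrA cE -exprM -exprD; apply/eqP.
  rewrite (eq_prim_root_expr (zetaP q0)) {2}(divn_eq c d).
  rewrite addnAC -mulnA -mulnDr Aj mulnA.
  by rewrite -modnDml modnMl add0n.
- by rewrite exprMn vq exprAC (prim_expr_order (zetaP q0)) expr1n mulr1.
Qed.

(** The torsion relations make each number of f a value that some Phi_a takes,
    after the change of commutators by constants that [coboundary_criterion]
    allows; the criterion then applies to Phi_a / f. *)
Lemma cocycle3_cohomologous_Phi f : cocycle3 f ->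
  exists2 a, admissible_index m a & cohomologous3 (Ph a) f.
Proof.
move=> cf; have m0 := coord_gt0 D; have nz := cocycle3_neq0 cf.
have ord l := coord_order D l.
have [a1 Ha1] := fin_all_exists (fun l =>
  let: exist i Ei := prim_rootP (zetaP (m0 l)) (slant_diag_root mulC cf (ord l)) in
  ex_intro (fun i : 'I_(m l) => slant f (m l) (x l) (x l) = zeta (m l) ^+ i) i Ei).
have [a2 Ha2] := fin_all_exists (fun st : 'I_n * 'I_n =>
  ex_normalizing_pair (m0 st.1) (m0 st.2)
    (slant_torsion mulC cf (ord st.1) (ord st.2))).
pose d r s t := gcdn (gcdn (m r) (m s)) (m t).
have d0 r s t : (0 < d r s t)%N by rewrite !gcdn_gt0 m0.
have Halt (p : 'I_n * 'I_n * 'I_n) : exists i : 'I_(d p.1.1 p.1.2 p.2),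
    alt3 f (x p.2) (x p.1.2) (x p.1.1) = zeta (d p.1.1 p.1.2 p.2) ^- i.
  case: p => [[r s] t] /=.
  have H l y z : alt3 f y z (x l) ^+ m l = 1 by apply: alt3_root (ord l).
  have : (alt3 f (x t) (x s) (x r))^-1 ^+ d r s t = 1.
    rewrite exprVn (expr_gcdn_eq1 _ (expr_gcdn_eq1 (m0 r) (H _ _ _) _)) ?invr1 //.
    - by rewrite gcdn_gt0 m0.
    - by rewrite -alt3_rot -alt3_rot H.
    - by rewrite -alt3_rot H.
  by case/(prim_rootP (zetaP (d0 r s t))) => i Ei; exists i; rewrite -Ei invrK.
have [a3 Ha3] := fin_all_exists Halt.
pose a := CocycleIndex (fun l => a1 l) (fun s t => (a2 (s, t)).1)
  (fun r s t => a3 (r, s, t)).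
have aa : admissible_index m a.
  by split=> [l|s t _|r s t _ _] //=; case: (Ha2 (s, t)).
exists a => //.
pose v s t := (a2 (s, t)).2.
have cPh := (Phi_normalized_cocycle D zetaP (PhE a)).1.
pose f' := [ffun p => Ph a p / f p].
have fE p : Ph a p = f p * f' p by rewrite ffunE mulrC divfK.
have cf' : cocycle3 f' by apply: cocycle3_div.
have v0 s t : v s t != 0.
  have [_ _ E] := Ha2 (s, t).
  have : v s t ^+ m t != 0 by rewrite /v E slant_neq0.
  by rewrite expf_eq0 m0.
(* The alternating family with entry v_st at (t, s), for s < t. *)
pose u (i j : 'I_n) := if i == j then 1 else if (j < i)%N then v j i else (v i j)^-1.
suff [h h0 Eh] : exists2 h, cochain2 h & forall p, f' p = coboundary2 h p.
  by exists h => // p; rewrite fE Eh.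
apply: (coboundary_criterion D cf' (u := u)).
- by move=> i; rewrite /u eqxx.
- move=> i j; rewrite /u eq_sym; case: eqP => [_|/eqP ij]; first by rewrite mulr1.
  by case: ltngtP => [||/val_inj/eqP]; rewrite ?(negPf ij) ?mulfV ?mulVf.
- move=> i h; have S := slantM (m i) (x i) (x h) fE.
  have s0 := slant_neq0 cf (m i) (x i) (x h).
  apply: (mulfI s0); rewrite -S /u eq_sym; have [<-|ih] := eqVneq i h.
    by rewrite expr1n mulr1 (slant_Phi_diag D zetaP (PhE a)).
  rewrite (slant_Phi D zetaP (PhE a)) //; case: ifP => lt.
    by have [_ -> _] := Ha2 (i, h).
  by have [_ _ E] := Ha2 (h, i); rewrite exprVn /v E mulfV.
apply: alt3_eq1 => [|r s t rs st]; first exact: cocycle3_neq0 cf'.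
have A := alt3M (x t) (x s) (x r) fE.
apply: (mulfI (alt3_neq0 cf (x t) (x s) (x r))); rewrite -A mulr1.
by rewrite (alt3_Phi D zetaP (PhE a)) // (Ha3 (r, s, t)).
Qed.

End Classification.

(** * The external product of cyclic groups *)

Section ProductGroup.
Variables (n : nat) (Z : 'I_n -> finGroupType) (m : 'I_n -> nat).
Hypothesis cardZ : forall l, #|[set: Z l]| = m l.
Variable g : forall l, Z l.
Hypothesis genZ : forall l, generator [set: Z l] (g l).

Lemma product_coordinates :
  cyclic_coordinates m (fun l => dfung1 (g l) : {dffun forall l, Z l})
    (fun l (u : {dffun forall l, Z l}) => exponent_of (g l) (u l)).
Proof.
have om l : #[g l]%g = m l.
  by rewrite -cardZ (eqP (genZ l)).
have m0 l : (0 < m l)%N by rewrite -om order_gt0.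
have expo l (y : Z l) : (exponent_of (g l) y < m l)%N /\
    (g l ^+ exponent_of (g l) y = y)%g.
  have : y \in <[g l]>%g by rewrite -(eqP (genZ l)) inE.
  by case/cyclePmin => i ig ->; rewrite exponent_of_expg // -om.
have expoX l i : exponent_of (g l) (g l ^+ i)%g = (i %% m l)%N.
  by rewrite -expg_mod_order om exponent_of_expg // om ltn_mod.
have dffunX (y : {dffun forall l, Z l}) d l : (y ^+ d)%g l = (y l ^+ d)%g.
  by elim: d => [|d IH]; rewrite ?ffunE // !expgS dffunM IH.
split.
- move=> y z; apply/ffunP => l; rewrite !dffunM.
  by rewrite -(expo l (y l)).2 -(expo l (z l)).2 -!expgD addnC.
- move=> i; apply/ffunP => l; rewrite dffunX [RHS]ffunE.
  have [<-|il] := eqVneq i l; first by rewrite dfung1_id -om expg_order.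
  by rewrite dfung1_dflt // expg1n.
- by move=> i y; case: (expo i (y i)).
- move=> i y z; rewrite dffunM -expoX expgD.
  by rewrite (expo i (y i)).2 (expo i (z i)).2.
- move=> i l; rewrite -expoX; congr (exponent_of _ _).
  have [<-|il] := eqVneq i l; first by rewrite dfung1_id expg1.
  by rewrite dfung1_dflt.
- move=> y; apply/ffunP => l; rewrite -/(monomial g _) monomialE.
  by rewrite (expo l (y l)).2.
Qed.

End ProductGroup.

Theorem proposition3p8 (k : closedFieldType) (char0 : [pchar k] =i pred0)
    (zeta : nat -> k)
    (zetaP : forall d : nat, (0 < d)%N -> d.-primitive_root (zeta d))
    (n : nat) (m : 'I_n -> nat) (Z : 'I_n -> finGroupType)
    (cardZ : forall l, #|[set: Z l]| = m l)
    (g : forall l, Z l) (genZ : forall l, generator [set: Z l] (g l)) :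
  complete_normalized_representatives3
    (fun F : {ffun {dffun forall l, Z l} * {dffun forall l, Z l}
                     * {dffun forall l, Z l} -> k} =>
       exists2 a : cocycle_index n, admissible_index m a & F = Phi zeta m g a).
Proof.
have D := product_coordinates cardZ genZ.
pose gT : finGroupType := {dffun forall l, Z l}.
pose Ph (a : cocycle_index n) : {ffun gT * gT * gT -> k} := Phi zeta m g a.
have PhE a u v w : Ph a (u, v, w) = Phi_exponents zeta m a
    (fun l => exponent_of (g l) (u l)) (fun l => exponent_of (g l) (v l))
    (fun l => exponent_of (g l) (w l)) by rewrite ffunE.
split=> [_ [a aa ->]|f cf].
  exact: (Phi_normalized_cocycle D zetaP (PhE a)).
have [a aa af] := cocycle3_cohomologous_Phi D zetaP PhE cf.
exists (Phi zeta m g a); split; first by split=> //; exists a.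
move=> _ [[b ab ->] [h h0 Eh]]; case: af => h' h'0 Eh'.
apply: (cohomologous_Phi_eq D zetaP PhE aa ab (h := [ffun p => h' p / h p])).
  by move=> p; rewrite ffunE mulf_neq0 ?invr_eq0.
move=> [[u v] w]; rewrite Eh' Eh !ffunE /=.
by field; rewrite !h0 !h'0.
Qed.
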